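(* The map $\Theta$ is an algebra isomorphism between the algebras $\mathrm{DAB}$ and $\mathcal{D}$.
   Context: **The algebra DAB.** Let $[n]=\{1,\dots,n\}$, $[n]'=\{i':i\in[n]\}$ a disjoint copy, and $\mathcal{E}=\{1,2,\ldots,1',2',\ldots\}$. For $\sigma\in\mathfrak{S}_n$ in one-line notation, with $\sigma_0=\sigma_{n+1}=\infty$, let $\mathrm{AB}(\sigma)=\{\sigma_i\in[n]:\sigma_i<\sigma_{i+1}\}$, $\mathrm{DB}(\sigma)=\{\sigma_i\in[n]:\sigma_{i-1}>\sigma_i\}$, and $w_1(\sigma)=\prod_{e\in\mathrm{DB}(\sigma)}z_e\prod_{e\in\mathrm{AB}(\sigma)}z_{e'}\in\mathbb{C}[z_e:e\in\mathcal{E}]$. For $e\in\mathcal{E}$, $\eta_e$ is the linear operator on $\mathbb{C}[z_e:e\in\mathcal{E}]$ that first sets $z_e=0$ and then multiplies by $z_e$. For finite $S\subseteq\mathcal{E}$, $\eta^S=\prod_{e\in S}\eta_e$ and $\partial^S=\prod_{e\in S}\partial/\partial z_e$ (identity if $S=\emptyset$). $\Gamma_k$ is the shift $z_i\mapsto z_{i+k}$, $z_{i'}\mapsto z_{(i+k)'}$ for all $i\geq1$. Let $$\mathrm{DAB}_n=\mathrm{span}_{\mathbb{C}}\{w_1(\sigma):\sigma\in\mathfrak{S}_n\},\qquad \mathrm{DAB}=\bigoplus_{n\geq0}\mathrm{DAB}_n,$$ with bilinear multiplication given by $f\bullet1=1\bullet f=f$ and, for $f\in\mathrm{DAB}_n$,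 $g\in\mathrm{DAB}_m$ with $mn\neq0$, $$f\bullet g=\sum_{T,S}\eta^T\partial^S\big(f\,\Gamma_n(g)\big),$$ the sum being over all $T\subseteq[n]\cup[n]'$ and $S\subseteq\{n+1,\dots,n+m\}\cup\{(n+1)',\dots,(n+m)'\}$ with $|S|=|T|+1$. **The Dyck algebra $\mathcal{D}$.** A Dyck path of length $2n$ is a path in $\mathbb{N}\times\mathbb{N}$ from $(0,0)$ to $(2n,0)$ with $2n$ steps, each $u=(1,1)$ or $d=(1,-1)$. The Dyck path $w_1\cdots w_{2n}$, $w_i\in\{u,d\}$, is coded by the word $v_1v_2\cdots v_{2n}=u\,w_1\cdots w_{2n-1}$ (for $n=0$, the empty word). On the space $\mathbb{C}\langle u,d\rangle$ of noncommutative polynomials define linear operators $\partial_i,\eta_i$ ($i\geq1$) on words $v_1\cdots v_n$: $\partial_i$ replaces $v_i$ by $d$ if $i\le n$ and $v_i=u$, and gives $0$ if $i>n$ or $v_i=d$; $\eta_i$ replaces $v_i$ by $u$ if $i\le n$ and $v_i=d$, and gives $0$ if $i>n$ or $v_i=u$. For finite $S\subset\{1,2,\dots\}$ put $\partial^S=\prod_{i\in S}\partial_i$, $\eta^S=\prod_{i\in S}\eta_i$. Define a bilinear product on $\mathbb{C}\langle u,d\rangle$ by $f\bullet1=1\bullet f=f$ and, for $m,n>0$, $$(w_1\cdots w_m)\bullet(v_1\cdots v_n)=\sum_{T,S}\eta^T(w_1\cdots w_m)\,\partial^S(v_1\cdots v_n),$$ the sum being over all finite $S,T\subset\{1,2,\ldots\}$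 with $|S|=|T|+1$ (the two words are concatenated). Let $\mathcal{D}_n\subset\mathbb{C}\langle u,d\rangle$ be the span of the codes $v_1\cdots v_{2n}$ of all Dyck paths of length $2n$, and $\mathcal{D}=\bigoplus_{n\geq0}\mathcal{D}_n$, with the product $\bullet$ (the product of two codes of Dyck paths is a sum of codes of Dyck paths). **The map $\Theta$.** $\Theta$ is the linear map on $\mathrm{DAB}$ that sends a monomial $M_n$ which is a basis element of $\mathrm{DAB}_n$ (i.e. $M_n=w_1(\sigma)$ for some $\sigma\in\mathfrak{S}_n$) to the word $v_1v_2\cdots v_{2n}$ in $\{u,d\}$ where, for each $i\in[n]$, $v_{2i-1}=u$ if and only if $z_i$ appears in $M_n$, and $v_{2i}=u$ if and only if $z_{i'}$ appears in $M_n$. *)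

(* Defs.v *)
From mathcomp Require Import all_boot all_order all_fingroup all_algebra.
From mathcomp Require Import finmap.
From mathcomp.multinomials Require Import monalg.
From mathcomp Require Import boolp classical_sets functions.

Set Implicit Arguments.
Unset Strict Implicit.
Unset Printing Implicit Defensive.

Import GRing.Theory.
Local Open Scope ring_scope.

(* Indices are shifted by one throughout: [n] is 'I_n = {0, ..., n-1}, and
   position i of a word is counted from 0. *)

(* inl i is the index i, inr i is the primed index i'. *)
Notation zindex := (nat + nat)%type.

Section LinearAlgebra.
Variable K : fieldType.

Definition lin_ext (M : choiceType) (V : lmodType K) (h : M -> V)
  (f : {malg K[M]}) : V := \sum_(m <- msupp f) f@_m *: h m.

Definition lin_span (V : lmodType K) (I : finType) (P : pred I) (b : I -> V) :
  set V := [set f | exists c : I -> K, f = \sum_(i | P i) c i *: b i].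

Definition direct_sum (V : lmodType K) (A : nat -> set V) : set (nat -> V) :=
  [set f | (forall n, A n (f n)) /\
           exists N : nat, forall n, (N <= n)%N -> f n = 0].

(* The bilinear product on a direct sum whose value on components of degrees
   n and m is mul n m, placed in degree n + m. *)
Definition graded_mul (V : lmodType K) (mul : nat -> nat -> V -> V -> V)
  (f g : nat -> V) : nat -> V :=
  fun k => \sum_(i < k.+1) mul i (k - i)%N (f i) (g (k - i)%N).

Definition graded_one (V : lmodType K) (e : V) : nat -> V :=
  fun n => if n == 0%N then e else 0.

Definition unital_closed (V : lmodType K) (A : set V) (mul : V -> V -> V)
  (e : V) : Prop :=
  A e /\ forall f g, A f -> A g -> A (mul f g).

Definition alg_isomorphism (V W : lmodType K)
  (A : set V) (mulA : V -> V -> V) (eA : V)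
  (B : set W) (mulB : W -> W -> W) (eB : W) (phi : V -> W) : Prop :=
  [/\ set_bij A B phi,
      forall (a : K) f g, A f -> A g -> phi (a *: f + g) = a *: phi f + phi g,
      phi eA = eB &
      forall f g, A f -> A g -> phi (mulA f g) = mulB (phi f) (phi g)].

End LinearAlgebra.

Section DAB.
Variable K : fieldType.

Definition shift_index (k : nat) (e : zindex) : zindex :=
  match e with inl i => inl (k + i)%N | inr i => inr (k + i)%N end.

Definition index_of_ord (n : nat) (e : 'I_n + 'I_n) : zindex :=
  match e with inl i => inl (val i) | inr i => inr (val i) end.

Local Notation zpoly := {malg K[{cmonom zindex}]}.

Definition z (e : zindex) : zpoly := << ucm e >>.

Definition subst (s : zindex -> zpoly) (f : zpoly) : zpoly :=
  lin_ext (fun m : {cmonom zindex} => \prod_(e <- finsupp m) s e ^+ m e) f.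

Definition eta (e : zindex) (f : zpoly) : zpoly :=
  z e * subst (fun x => if x == e then 0 else z x) f.

Definition partial (e : zindex) (f : zpoly) : zpoly :=
  lin_ext (fun m : {cmonom zindex} => << (m e)%:R *g divcm m (ucm e) >>) f.

Definition Gamma (k : nat) (f : zpoly) : zpoly :=
  subst (fun e => z (shift_index k e)) f.

(* The operators eta e commute, and so do the operators partial e: the order of
   the composition along s is irrelevant. *)
Definition eta_seq (s : seq zindex) (f : zpoly) : zpoly := foldr eta f s.
Definition partial_seq (s : seq zindex) (f : zpoly) : zpoly := foldr partial f s.

(* The letters of s are less than n, so the default value n of nth plays the
   role of the boundary letters sigma_0 = sigma_(n+1) = oo. *)
Definition one_line (n : nat) (s : 'S_n) : seq nat :=
  [seq val (s i) | i <- enum 'I_n].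
Definition AB (n : nat) (s : 'S_n) : {set 'I_n} :=
  [set s i | i : 'I_n & (s i < nth n (one_line s) i.+1)%N].
Definition DB (n : nat) (s : 'S_n) : {set 'I_n} :=
  [set s i | i : 'I_n & (nth n (n :: one_line s) i > s i)%N].

Definition w1 (n : nat) (s : 'S_n) : zpoly :=
  \prod_(e in DB s) z (inl (val e)) * \prod_(e in AB s) z (inr (val e)).

Definition DABn (n : nat) : set zpoly := lin_span predT (@w1 n).

(* If n = 0 or m = 0 then one of the factors is a constant polynomial, and the
   rule 1 * f = f * 1 = f extends to the usual product. *)
Definition DABn_mul (n m : nat) (f g : zpoly) : zpoly :=
  if (n == 0%N) || (m == 0%N) then f * g else
  \sum_(T : {set 'I_n + 'I_n})
    \sum_(S : {set 'I_m + 'I_m} | #|S| == #|T|.+1)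
      eta_seq [seq index_of_ord e | e <- enum T]
        (partial_seq [seq shift_index n (index_of_ord e) | e <- enum S]
          (f * Gamma n g)).

Definition DAB : set (nat -> zpoly) := direct_sum DABn.
Definition DAB_mul : (nat -> zpoly) -> (nat -> zpoly) -> nat -> zpoly :=
  graded_mul DABn_mul.
Definition DAB_one : nat -> zpoly := graded_one 1.

End DAB.

Section Dyck.
Variable K : fieldType.

(* Letters are booleans: true is u and false is d. *)
Local Notation ncpoly := {malg K[{fmonom bool}]}.

Definition word (s : seq bool) : ncpoly := << FMonom s >>.

Definition dpartial (i : nat) (f : ncpoly) : ncpoly :=
  lin_ext (fun v : {fmonom bool} =>
    if (i < size v)%N && nth false v i then word (set_nth false v i false)
    else 0) f.

Definition deta (i : nat) (f : ncpoly) : ncpoly :=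
  lin_ext (fun v : {fmonom bool} =>
    if (i < size v)%N && ~~ nth false v i then word (set_nth false v i true)
    else 0) f.

(* Here too the composed operators commute. *)
Definition dpartial_seq (s : seq nat) (f : ncpoly) : ncpoly :=
  foldr dpartial f s.
Definition deta_seq (s : seq nat) (f : ncpoly) : ncpoly := foldr deta f s.

(* Only the positions of w (resp. v) can occur in a set T (resp. S) with a
   nonzero contribution, so the sum over all finite sets of positive integers
   is a sum over the subsets of these positions. *)
Definition word_mul (w v : seq bool) : ncpoly :=
  if (w == [::]) || (v == [::]) then word w * word v else
  \sum_(T : {set 'I_(size w)})
    \sum_(S : {set 'I_(size v)} | #|S| == #|T|.+1)
      deta_seq [seq val i | i <- enum T] (word w) *
      dpartial_seq [seq val i | i <- enum S] (word v).

Definition ncpoly_mul (f g : ncpoly) : ncpoly :=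
  lin_ext (fun w : {fmonom bool} =>
    lin_ext (fun v : {fmonom bool} => word_mul w v) g) f.

Definition height (w : seq bool) : int :=
  (count_mem true w)%:Z - (count_mem false w)%:Z.

Definition dyck_path (w : seq bool) : bool :=
  all (fun k => 0 <= height (take k w)) (iota 0 (size w).+1) &&
  (height w == 0).

(* belast true w is u followed by w without its last letter, and is empty if w
   is empty. *)
Definition dyck_code (w : seq bool) : seq bool := belast true w.

Definition Dyckn (n : nat) : set ncpoly :=
  lin_span (fun w : (n.*2).-tuple bool => dyck_path w)
    (fun w => word (dyck_code w)).

(* Dyckn n lies in the span of the words of length 2n, so the external direct
   sum below is the internal one, and the product is that of ncpoly. *)
Definition Dyck : set (nat -> ncpoly) := direct_sum Dyckn.
Definition Dyck_mul : (nat -> ncpoly) -> (nat -> ncpoly) -> nat -> ncpoly :=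
  graded_mul (fun _ _ => ncpoly_mul).
Definition Dyck_one : nat -> ncpoly := graded_one (word [::]).

End Dyck.

Section Theta.
Variable K : fieldType.

Definition theta_word (n : nat) (M : {cmonom zindex}) : seq bool :=
  flatten [seq [:: M (inl i) != 0%N; M (inr i) != 0%N] | i <- iota 0 n].

(* The distinct monomials w1 sigma form a basis of DABn, so on DABn this is the
   linear map determined by their images. *)
Definition Theta_n (n : nat) (f : {malg K[{cmonom zindex}]}) :
  {malg K[{fmonom bool}]} :=
  lin_ext (fun M : {cmonom zindex} => word K (theta_word n M)) f.

Definition Theta (f : nat -> {malg K[{cmonom zindex}]}) :
  nat -> {malg K[{fmonom bool}]} :=
  fun n => Theta_n n (f n).

End Theta.

(* Main.v *)
(* A permutation sigma and its word v = Theta (w1 sigma) are related as follows: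
   each pair of neighbours a < b of the word oo sigma oo contributes a letter u
   in the slots of a (in v_(2a-1) or v_(2a)) and, if b <> oo, a letter d in the
   slots of b.  Hence the number of u's minus the number of d's among the first
   2k letters of v is the number of neighbours of which exactly one is at most
   k.  This is positive and even for 1 <= k <= n, and 2 for k = n, which says
   that v codes a Dyck path.  Conversely the letters 1, 2, ..., n can be placed
   one by one as v prescribes, so all codes occur.
   The distinct monomials w1 sigma thus correspond to the codes under Theta; on
   them eta and d/dz turn one letter d into u and one letter u into d, exactly
   as in the product of the Dyck algebra.  That product preserves codes: raising
   |T| letters of the first word leaves it at height 2 + 2|T|, from where
   lowering |T| + 1 letters of the second word keeps all heights positive. *)

Require Import Defs.
From mathcomp Require Import all_boot all_order all_fingroup all_algebra.
From mathcomp Require Import finmap boolp classical_sets functions reals.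
From mathcomp.multinomials Require Import monalg.
From mathcomp.real_closed Require Import complex.
From mathcomp Require Import zify.

Set Implicit Arguments.
Unset Strict Implicit.
Unset Printing Implicit Defensive.

Import GRing.Theory Num.Theory.
Local Open Scope ring_scope.

(** * Linear maps, linear extension and spans *)

Section LinearMaps.
Variable K : fieldType.

Lemma linear_map0 (V W : lmodType K) (f : V -> W) : linear f -> f 0 = 0.
Proof.
by move=> lf; have := lf (- 1) 0 0; rewrite scaler0 addr0 scaleN1r addNr.
Qed.

Lemma linear_mapD (V W : lmodType K) (f : V -> W) :
  linear f -> {morph f : x y / x + y}.
Proof. by move=> lf x y; have := lf 1 x y; rewrite !scale1r. Qed.

Lemma linear_mapZ (V W : lmodType K) (f : V -> W) a x :
  linear f -> f (a *: x) = a *: f x.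
Proof. by move=> lf; have := lf a x 0; rewrite addr0 (linear_map0 lf) addr0. Qed.

Lemma linear_map_sum (V W : lmodType K) (f : V -> W) I (r : seq I) P F :
  linear f -> f (\sum_(i <- r | P i) F i) = \sum_(i <- r | P i) f (F i).
Proof.
by move=> lf; apply: (big_morph f (linear_mapD lf) (linear_map0 lf)).
Qed.

Lemma linear_big (V W : lmodType K) I (r : seq I) P (F : I -> V -> W) :
  (forall i, linear (F i)) -> linear (fun x => \sum_(i <- r | P i) F i x).
Proof.
move=> lF a x y; rewrite scaler_sumr -big_split /=.
by apply: eq_bigr => i _; rewrite lF.
Qed.

Lemma linear_foldr (V : lmodType K) I (F : I -> V -> V) (s : seq I) :
  (forall i, linear (F i)) -> linear (fun x => foldr F x s).
Proof. by move=> lF a x y; elim: s => //= i s ->; rewrite lF. Qed.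

Section LinExt.
Variables (M : choiceType) (V : lmodType K) (h : M -> V).

(** Monomials outside the support have coefficient 0. Any larger finite set may thus replace the
    support, so that linearity can be checked over one common set. *)
Lemma lin_extEw (D : {fset M}) (f : {malg K[M]}) : (msupp f `<=` D)%fset ->
  lin_ext h f = \sum_(m <- D) f@_m *: h m.
Proof.
move=> le; rewrite /lin_ext (big_fset_incl _ le) //= => m _ /mcoeff_outdom ->.
by rewrite scale0r.
Qed.

Lemma lin_ext_linear : linear (lin_ext h).
Proof.
move=> a f g; pose D := (msupp f `|` msupp g)%fset.
rewrite (@lin_extEw D f) ?fsubsetUl // (@lin_extEw D g) ?fsubsetUr //.
rewrite (@lin_extEw D); last first.
  apply: fsubset_trans (msuppD_le _ _) _.
  by rewrite fsetSU // msuppZ_le.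
rewrite scaler_sumr -big_split; apply: eq_bigr => m _ /=.
by rewrite mcoeffD mcoeffZ scalerDl scalerA.
Qed.

Lemma lin_extU (m : M) : lin_ext h << m >> = h m.
Proof. by rewrite /lin_ext msuppU oner_eq0 big_seq_fset1 mcoeffUU scale1r. Qed.

End LinExt.

Section LinSpan.
Variables (V : lmodType K) (I : finType) (P : pred I) (b : I -> V).
Local Notation S := (lin_span P b).

Lemma lin_span_gen i : P i -> S (b i).
Proof.
move=> Pi; exists (fun j => (j == i)%:R).
rewrite (bigD1 i) //= eqxx scale1r big1 ?addr0 // => j /andP[_ /negPf->].
by rewrite scale0r.
Qed.

Lemma lin_spanZD a x y : S x -> S y -> S (a *: x + y).
Proof.
move=> [c ->] [d ->]; exists (fun i => a * c i + d i).
rewrite scaler_sumr -big_split; apply: eq_bigr => i _ /=.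
by rewrite scalerDl scalerA.
Qed.

Lemma lin_span0 : S 0.
Proof.
by exists (fun=> 0); rewrite big1 // => i _; rewrite scale0r.
Qed.

Lemma lin_span_sum J (r : seq J) (Q : pred J) F :
  (forall j, Q j -> S (F j)) -> S (\sum_(j <- r | Q j) F j).
Proof.
move=> SF; elim/big_ind: _ => [|x y Sx Sy|j /SF //]; first exact: lin_span0.
by rewrite -[x]scale1r; apply: lin_spanZD.
Qed.

Lemma lin_span_ind (Q : V -> Prop) :
  Q 0 -> (forall a x y, Q x -> Q y -> Q (a *: x + y)) ->
  (forall i, P i -> Q (b i)) -> forall x, S x -> Q x.
Proof.
move=> Q0 QZD Qb x [c ->]; elim/big_rec: _ => // i y Pi Qy.
by apply: QZD => //; apply: Qb.
Qed.

End LinSpan.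
End LinearMaps.

(** * Words as square-free monomials *)

Definition zpos (p : nat) : zindex := if odd p then inr p./2 else inl p./2.

Definition zrank (e : zindex) : nat :=
  match e with inl i => i.*2 | inr i => i.*2.+1 end.

Lemma zposK : cancel zpos zrank.
Proof. by move=> p; rewrite /zpos; case: ifP => /= op; lia. Qed.

Lemma zrankK : cancel zrank zpos.
Proof. by case=> i; rewrite /zpos /= odd_double /= ?uphalf_double ?doubleK. Qed.

Lemma zrank_shift n e : zrank (shift_index n e) = (n.*2 + zrank e)%N.
Proof. by case: e => i /=; rewrite doubleD ?addnS. Qed.

Lemma zpos_shift n p : shift_index n (zpos p) = zpos (n.*2 + p).
Proof. by apply: (can_inj zrankK); rewrite zrank_shift !zposK. Qed.

(** This is the inverse of [theta_word] on square-free monomials. The finite set only has to contain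
    the support: letters [d] and, through the default [false], positions beyond the word give
    exponent 0. *)
Definition mon (v : seq bool) : {cmonom zindex} :=
  [cmonom nat_of_bool (nth false v (zrank e)) |
     e in [fset zpos p | p in iota 0 (size v)]]%M.

Lemma monE v e : mon v e = nth false v (zrank e) :> nat.
Proof.
rewrite /mon cmE fsfun_fun; case: ifP => // /negP ne.
rewrite nth_default // leqNgt; apply/negP => lt; apply: ne.
apply/imfsetP; exists (zrank e); first by rewrite /= mem_iota.
by rewrite zrankK.
Qed.

Lemma mem_mon v e : (e \in finsupp (mon v)) = nth false v (zrank e).
Proof. by rewrite -cmE_neq0 monE; case: nth. Qed.

Lemma mon_eq1 v e : e \in finsupp (mon v) -> mon v e = 1%N.
Proof. by rewrite mem_mon monE => ->. Qed.

Lemma theta_wordS n M : theta_word n.+1 M =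
  theta_word n M ++ [:: M (inl n) != 0%N; M (inr n) != 0%N].
Proof. by rewrite /theta_word -addn1 iotaD map_cat flatten_cat. Qed.

Lemma size_theta_word n M : size (theta_word n M) = n.*2.
Proof. by elim: n => // n IH; rewrite theta_wordS size_cat IH /=; lia. Qed.

Lemma nth_theta_word n M p : (p < n.*2)%N ->
  nth false (theta_word n M) p = (M (zpos p) != 0%N).
Proof.
elim: n => // n IH lt; rewrite theta_wordS nth_cat size_theta_word.
case: ltnP => [/IH //|le].
have [->|->] : (p = n.*2 \/ p = n.*2.+1)%N by lia.
  by rewrite subnn /zpos odd_double doubleK.
by rewrite subSn ?leqnn // subnn /zpos /= odd_double /= uphalf_double.
Qed.

Lemma theta_word_mon n v : size v = n.*2 -> theta_word n (mon v) = v.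
Proof.
move=> sv; apply: (@eq_from_nth _ false) => [|p]; rewrite size_theta_word //.
by move=> /nth_theta_word ->; rewrite monE zposK; case: nth.
Qed.

(** A word records only whether an exponent vanishes, so a monomial is recovered when it is
    square-free and involves only the first [n] indices of each kind. *)
Lemma mon_theta_word n (M : {cmonom zindex}) : (forall e, (M e <= 1)%N) ->
  (forall e, (n.*2 <= zrank e)%N -> M e = 0%N) -> mon (theta_word n M) = M.
Proof.
move=> le1 M0; apply/eqP/cmP => e; rewrite monE.
case: (ltnP (zrank e) n.*2) => [lt|ge].
  by rewrite nth_theta_word // zrankK; case: (M e) (le1 e) => [|[]].
by rewrite M0 // nth_default // size_theta_word.
Qed.

Lemma take_theta_word n k M :
  (k <= n)%N -> take k.*2 (theta_word n M) = theta_word k M.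
Proof.
move=> le; apply: (@eq_from_nth _ false) => [|p].
  by rewrite size_takel !size_theta_word ?leq_double.
rewrite size_takel ?size_theta_word ?leq_double // => lt.
by rewrite nth_take // !nth_theta_word // (leq_trans lt) // leq_double.
Qed.

(** * The operators on words and on monomials *)

Section Flips.
Variable K : fieldType.
Local Notation zpoly := {malg K[{cmonom zindex}]}.
Local Notation ncpoly := {malg K[{fmonom bool}]}.
Local Notation word := (word K).

Lemma wordM s t : word s * word t = word (s ++ t).
Proof.
rewrite /Defs.word malgM_def fgmulUU mulr1.
by rewrite /mmul /= fmmulE.
Qed.

Lemma malgUM (M : monomType) (m1 m2 : M) :
  << m1 >> * << m2 >> = << mmul m1 m2 >> :> {malg K[M]}.
Proof. by rewrite malgM_def fgmulUU mulr1. Qed.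

Lemma malg_scalerAr (M : conomType) a (f g : {malg K[M]}) :
  f * (a *: g) = a *: (f * g).
Proof. by rewrite -!mul_malgC mulrCA. Qed.

Lemma malgU_prod (M : conomType) I (r : seq I) (P : pred I) (F : I -> M) :
  \prod_(i <- r | P i) << F i >> =
  << \big[mmul/mone]_(i <- r | P i) F i >> :> {malg K[M]}.
Proof.
symmetry; apply: (big_morph (fun m : M => << m >> : {malg K[M]})) => [x y|].
  by rewrite malgUM.
by [].
Qed.

Lemma cm_prod I (r : seq I) (P : pred I) (F : I -> {cmonom zindex}) e :
  (\big[mmul/mone]_(i <- r | P i) F i) e = (\sum_(i <- r | P i) F i e)%N.
Proof.
by apply: (big_morph (fun m : {cmonom zindex} => m e)) => [x y|];
  rewrite ?cmM ?cm1.
Qed.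

(** One map serves as inverse of [Theta_n] for all [n]: words that differ by trailing letters [d]
    have the same monomial, and the degree tells them apart. *)
Definition Psi : ncpoly -> zpoly := lin_ext (fun v : {fmonom bool} => << mon v >>).

Lemma Psi_word v : Psi (word v) = << mon v >>.
Proof. exact: lin_extU. Qed.

Lemma Theta_n_Psi_word n v :
  size v = n.*2 -> Theta_n n (Psi (word v)) = word v.
Proof. by move=> sv; rewrite Psi_word /Theta_n lin_extU theta_word_mon. Qed.

Lemma subst_mon s v :
  subst s << mon v >> = \prod_(e <- finsupp (mon v)) s e :> zpoly.
Proof.
rewrite /subst lin_extU; apply: eq_big_seq => e /mon_eq1 ->.
by rewrite expr1.
Qed.

Lemma prod_z_mon v : \prod_(e <- finsupp (mon v)) z K e = << mon v >>.
Proof.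
rewrite malgU_prod; congr (<< _ >>); apply/eqP/cmP => x.
rewrite cm_prod (eq_bigr (fun e => nat_of_bool (e == x))); last first.
  by move=> e _; rewrite cmU.
rewrite monE -mem_mon; have [xm|xm] := boolP (x \in _).
  by rewrite (big_fsetD1 x) //= eqxx big1_fset // => e; rewrite !inE => /andP[/negPf->].
rewrite big1_fset // => e em _; case: eqP => // ex.
by rewrite -ex em in xm.
Qed.

Lemma eta_mon p v : (p < size v)%N ->
  eta (zpos p) << mon v >> =
  (if nth false v p then 0 else << mon (set_nth false v p true) >>) :> zpoly.
Proof.
move=> lt; rewrite /eta subst_mon; case: ifP => vp.
  by rewrite (big_fsetD1 (zpos p)) ?mem_mon ?zposK //= eqxx mul0r mulr0.
rewrite (eq_big_seq (z K)); last first.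
  move=> e; rewrite mem_mon; case: eqP => // ->.
  by rewrite zposK vp.
rewrite prod_z_mon /z malgUM; congr (<< _ >>); apply/eqP/cmP => e.
rewrite cmM cmU !monE nth_set_nth /= (can2_eq zposK zrankK) eq_sym.
by case: eqP => // ->; rewrite vp.
Qed.

(** The exponent is 0 or 1, so the derivative brings no numerical factor. *)
Lemma partial_mon p v :
  partial (zpos p) << mon v >> =
  (if nth false v p then << mon (set_nth false v p false) >> else 0) :> zpoly.
Proof.
rewrite /partial lin_extU monE zposK; case: ifP => vp; last by rewrite monalgU0.
congr (<< _ >>); apply/eqP/cmP => e.
rewrite divcmE ucmE !monE nth_set_nth /= (can2_eq zposK zrankK) eq_sym.
by case: eqP => [->|_]; rewrite ?vp ?subn0.
Qed.

(** As [w] has length [2n], the shift of the indices by [n] moves the letters of [v] exactly past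
    those of [w]. *)
Lemma Gamma_mon n w v : size w = n.*2 ->
  << mon w >> * Gamma n << mon v >> = << mon (w ++ v) >> :> zpoly.
Proof.
move=> sw; rewrite /Gamma subst_mon malgU_prod malgUM; congr (<< _ >>).
apply/eqP/cmP => x; rewrite cmM cm_prod !monE nth_cat sw.
under eq_bigr do rewrite cmU.
case: ltnP => [lt|ge].
  rewrite big1 ?addn0 // => e _; case: eqP => // ex.
  by move: lt; rewrite -ex zrank_shift ltnNge leq_addr.
rewrite nth_default ?sw // add0n.
have -> : x = shift_index n (zpos (zrank x - n.*2)).
  by rewrite zpos_shift subnKC // zrankK.
set y := zpos _; have -> : (zrank (shift_index n y) - n.*2 = zrank y)%N.
  by rewrite zrank_shift addKn.
rewrite -monE.
have inj e : (shift_index n e == shift_index n y) = (e == y).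
  apply/eqP/eqP => [/(congr1 zrank)|->//]; rewrite !zrank_shift => /addnI.
  exact: (can_inj zrankK).
under eq_bigr do rewrite inj.
have [xm|xm] := boolP (y \in finsupp (mon v)).
  rewrite (big_fsetD1 y) //= eqxx mon_eq1 // big1_fset // => e.
  by rewrite !inE => /andP[/negPf->].
rewrite big1_fset; first by move: xm; rewrite -cmE_neq0 negbK => /eqP.
by move=> e em _; case: eqP => // ex; rewrite -ex em in xm.
Qed.

(* flip b p turns letter p from ~~ b into b and zflip b is its counterpart on
   polynomials, so that the pairs (deta, eta) and (dpartial, partial) are
   treated at once. *)
Definition flip (b : bool) : nat -> ncpoly -> ncpoly :=
  if b then @deta K else @dpartial K.
Definition zflip (b : bool) : zindex -> zpoly -> zpoly :=
  if b then @eta K else @partial K.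

Lemma flip_word b p v : flip b p (word v) =
  if (p < size v)%N && (nth false v p != b) then word (set_nth false v p b)
  else 0.
Proof.
by case: b; rewrite /flip /deta /dpartial lin_extU /=; case: nth.
Qed.

Lemma flip_linear b p : linear (flip b p).
Proof. by case: b; apply: lin_ext_linear. Qed.

Lemma zflip_linear b e : linear (zflip b e).
Proof.
case: b => [a f g|]; last exact: lin_ext_linear.
by rewrite /zflip /eta [subst _ _]lin_ext_linear mulrDr malg_scalerAr.
Qed.

Lemma flip0 b p : flip b p 0 = 0.
Proof. exact/linear_map0/flip_linear. Qed.

Lemma zflip0 b e : zflip b e 0 = 0.
Proof. exact/linear_map0/zflip_linear. Qed.

Lemma Psi0 : Psi 0 = 0.
Proof. exact/linear_map0/lin_ext_linear. Qed.

Lemma zflip_Psi b p v : (p < size v)%N ->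
  zflip b (zpos p) (Psi (word v)) = Psi (flip b p (word v)).
Proof.
move=> lt; rewrite flip_word lt Psi_word.
case: b => /=; rewrite ?eta_mon ?partial_mon //;
  by case: nth; rewrite ?Psi_word ?Psi0.
Qed.

(** A flip may annihilate a word but otherwise keeps its length. This invariant keeps positions in
    range through a composition of flips, without tracking which letters have changed. *)
Definition word_or_zero (N : nat) (x : ncpoly) : Prop :=
  x = 0 \/ exists2 v, size v = N & x = word v.

Lemma word_or_zero_flip b p N x : word_or_zero N x -> word_or_zero N (flip b p x).
Proof.
move=> [->|[v sv ->]]; first by left; rewrite flip0.
rewrite flip_word; case: ifP => [/andP[lt _]|_]; last by left.
right; exists (set_nth false v p b) => //.
by rewrite size_set_nth -sv; apply/maxn_idPr.
Qed.

Definition flips b (s : seq nat) (x : ncpoly) := foldr (flip b) x s.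

Lemma word_or_zero_flips b s N x :
  word_or_zero N x -> word_or_zero N (flips b s x).
Proof. by move=> Nx; elim: s => //= p s; apply: word_or_zero_flip. Qed.

Lemma zflips_Psi b s N x : all (fun p => p < N)%N s -> word_or_zero N x ->
  foldr (zflip b) (Psi x) [seq zpos p | p <- s] = Psi (flips b s x).
Proof.
move=> + Nx; elim: s => //= p s IH /andP[lt /IH ->].
case: (word_or_zero_flips b s Nx) => [->|[v sv ->]].
  by rewrite flip0 Psi0 zflip0.
by rewrite zflip_Psi ?sv.
Qed.

(** Flips at different positions test and change different letters. By linearity it is enough to
    compare them on single words. *)
Lemma flipC b p q x :
  flip b p (flip b q x) = flip b q (flip b p x).
Proof.
have [->//|npq] := eqVneq p q.
rewrite [x]monalgE !(linear_map_sum _ _ _ (flip_linear b _)).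
apply: eq_bigr => v _; have -> : << x@_v *g v >> = x@_v *: word v.
  apply/malgP => m; rewrite mcoeffZ !mcoeffU /= fmK.
  by case: eqP; rewrite ?mulr1 ?mulr0.
have lZ r a y : flip b r (a *: y) = a *: flip b r y.
  exact/linear_mapZ/flip_linear.
have lZ2 r t a y : flip b r (flip b t (a *: y)) = a *: flip b r (flip b t y).
  by rewrite (lZ t a y) (lZ r a (flip b t y)).
rewrite (lZ2 p q) (lZ2 q p) !flip_word.
have aux r t : r != t -> flip b t (if (r < size v)%N && (nth false v r != b)
    then word (set_nth false v r b) else 0) =
  if [&& (r < size v)%N, nth false v r != b, (t < size v)%N &
         nth false v t != b] then word (set_nth false (set_nth false v r b) t b)
  else 0.
  move=> nrt; case: ifP => [/andP[lr br]|nr]; last first.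
    by rewrite flip0 andbA nr.
  rewrite flip_word lr br nth_set_nth /= [t == r]eq_sym (negPf nrt).
  by rewrite size_set_nth (maxn_idPr lr).
have nqp : q != p by rewrite eq_sym.
rewrite (aux q p nqp) (aux p q npq).
rewrite set_set_nth (negPf nqp).
have andC (A B C D : bool) : [&& A, B, C & D] = [&& C, D, A & B].
  by case: A B C D => [] [] [] [].
by rewrite [X in if X then _ else _]andC.
Qed.

(** The index sets of DAB and the position sets of the Dyck product may be enumerated in different
    orders; this makes the order irrelevant. *)
Lemma perm_flips b s t x : perm_eq s t -> flips b s x = flips b t x.
Proof.
have rem p : forall u : seq nat, p \in u ->
    flips b u x = flip b p (flips b (rem p u) x).
  elim=> //= q u IH; rewrite inE eq_sym; case: eqP => [->//|_] /= /IH ->.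
  by rewrite flipC.
elim: s t => [|p s IH] t; first by rewrite perm_sym => /perm_nilP ->.
move=> st; have pt : p \in t by rewrite -(perm_mem st) mem_head.
rewrite (rem p t pt) /=; congr (flip b p _); apply: IH.
by rewrite -(perm_cons p) (perm_trans st) // perm_to_rem.
Qed.

Lemma flip_mull b p M N x y : (p < N)%N -> word_or_zero N x ->
  word_or_zero M y -> flip b p (x * y) = flip b p x * y.
Proof.
move=> lt [->|[v sv ->]]; first by rewrite !(flip0, mul0r).
move=> [->|[w _ ->]]; first by rewrite !mulr0 flip0.
rewrite wordM !flip_word size_cat nth_cat sv lt (ltn_addr _ lt) /=.
case: ifP => _; last by rewrite mul0r.
rewrite wordM !set_nthE size_cat sv lt (ltn_addr _ lt) take_cat sv lt.
rewrite -catA cat_cons drop_cat sv; case: ltnP => [_|le].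
  by [].
have -> : p.+1 = N by lia.
by rewrite subnn drop0 drop_oversize ?sv.
Qed.

Lemma flip_mulr b p M N x y : word_or_zero N x ->
  word_or_zero M y -> flip b (N + p) (x * y) = x * flip b p y.
Proof.
move=> [->|[v sv ->]]; first by rewrite !(flip0, mul0r).
move=> [->|[w _ ->]]; first by rewrite flip0 !mulr0 flip0.
have nlt q : (N + q < N)%N = false by lia.
rewrite wordM !flip_word size_cat nth_cat sv ltn_add2l nlt addKn.
case: ifP => [/andP[lt _]|]; last by rewrite mulr0.
rewrite wordM !set_nthE size_cat sv ltn_add2l lt take_cat sv nlt addKn.
by rewrite drop_cat sv -addnS nlt addKn -catA.
Qed.

(** Positions below [N] lie in the left factor and positions shifted by [N] in the right one, so
    operators on the concatenation separate into operators on each factor. *)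
Lemma flips_cat b c M N s t x y : all (fun p => p < N)%N s ->
  word_or_zero N x -> word_or_zero M y ->
  flips b s (flips c [seq (N + p)%N | p <- t] (x * y)) =
  flips b s x * flips c t y.
Proof.
move=> sN Nx My.
have -> : flips c [seq (N + p)%N | p <- t] (x * y) = x * flips c t y.
  elim: t => [//|p t IH]; rewrite /flips map_cons [LHS]/= -/(flips c _ _) IH.
  exact/(flip_mulr _ _ Nx)/(word_or_zero_flips _ _ My).
elim: s sN => //= p s IH /andP[lt /IH ->].
by apply: (flip_mull _ lt); apply: word_or_zero_flips; eassumption.
Qed.

End Flips.

(** * Heights of words and Dyck codes *)

Lemma height_cons b w :
  height (b :: w) = (if b then 1 else -1) + height w.
Proof. by rewrite /height /=; case: b => /=; lia. Qed.

Lemma height_cat u w : height (u ++ w) = height u + height w.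
Proof. by rewrite /height !count_cat; lia. Qed.

(** The height has the parity of the length; on a prefix of even length a positive height is
    therefore at least 2. *)
Lemma height_size w : height w = (count_mem true w).*2%:Z - (size w)%:Z.
Proof.
rewrite /height -(count_predC (pred1 true) w).
rewrite (@eq_count _ (predC (pred1 true)) (pred1 false)); last by case.
lia.
Qed.

Lemma height_take_set_nth b v p k : (p < size v)%N -> nth false v p != b ->
  height (take k (set_nth false v p b)) =
  height (take k v) + (if (p < k)%N then (if b then 2 else - 2) else 0).
Proof.
elim: v p k => // c v IH [|p] [|k] //= lt; rewrite !height_cons.
  by case: c; case: b {IH} => //= _; lia.
by move=> /(IH _ k lt) ->; rewrite ltnS addrA.
Qed.

Lemma height_take_succ k v : (k < size v)%N ->
  height (take k.+1 v) = height (take k v) + (if nth false v k then 1 else - 1).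
Proof.
by move=> lt; rewrite (take_nth false) // -cats1 height_cat height_cons /height
  /=; case: nth; lia.
Qed.

(* Removing the last letter of a Dyck path and prefixing u turns the condition
   "all heights are nonnegative and the last one is 0" into this one. *)
Definition dyck_coded (v : seq bool) : Prop := v = [::] \/ height v = 2 /\
  forall k, (0 < k <= size v)%N -> 1 <= height (take k v).

Lemma dyck_pathP w : reflect
  (height w = 0 /\ forall k, (k <= size w)%N -> 0 <= height (take k w))
  (dyck_path w).
Proof.
apply: (iffP andP) => [[/allP a /eqP h]|[h a]]; split=> //.
- by move=> k le; apply: a; rewrite mem_iota.
- by apply/allP => k; rewrite mem_iota => /andP[_]; rewrite add0n ltnS; apply: a.
- by rewrite h.
Qed.

Lemma dyck_path_coded w : dyck_path w -> dyck_coded (dyck_code w).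
Proof.
case/dyck_pathP => h a; rewrite /dyck_code; case/lastP: w h a => [|w b] h a.
  by left.
rewrite belast_rcons; right.
have hw k : (k <= size w)%N -> 0 <= height (take k w).
  move=> le; have := a k; rewrite size_rcons -cats1 takel_cat //.
  by apply; apply: leqW.
(* A path that ends at 0 is at height 1 or -1 before its last step, and nonnegativity excludes
   -1. *)
have [hwb|hb] : height w = 1 \/ height w = -1.
  by move: h; rewrite -cats1 height_cat height_cons /height /=; case: (b); lia.
  split=> [|[|k] //= le]; rewrite height_cons ?hwb //.
  by have := hw k le; lia.
by have := hw _ (leqnn _); rewrite take_size hb.
Qed.

Lemma dyck_coded_path n v : size v = n.*2 -> dyck_coded v ->
  exists2 w : (n.*2).-tuple bool, dyck_path w & v = dyck_code w.
Proof.
move=> sv [v0|[h a]].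
  have n0 : n = 0%N by move: sv; rewrite v0 /=; lia.
  by subst n; exists [tuple]; rewrite // v0.
case: v sv h a => [//|c v] sv h a.
(* The height condition on the prefix of length one forces the first letter to be [u]. *)
have hv : height v = 1 /\ c.
  by have := a 1%N isT; move: h; rewrite /= take0 !height_cons /height /=; case: (c); lia.
have sw : size (rcons v false) == n.*2 by rewrite size_rcons -sv.
exists (Tuple sw); last first.
  by rewrite /dyck_code /= belast_rcons; case: hv => _ ->.
apply/dyck_pathP => /=; rewrite -cats1; split.
  by rewrite height_cat height_cons (proj1 hv).
move=> k; rewrite size_cat addn1 leq_eqVlt ltnS => /orP[/eqP->|le].
  by rewrite take_oversize ?size_cat ?addn1 // height_cat height_cons (proj1 hv).
rewrite takel_cat //; have := a k.+1 le; rewrite /= height_cons.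
by case: hv => _ ->; lia.
Qed.

(** * Spans of Dyck codes, and heights after flips *)

Section Span.
Variable K : fieldType.
Local Notation ncpoly := {malg K[{fmonom bool}]}.
Local Notation word := (word K).

Lemma Dyckn_word n v : size v = n.*2 -> dyck_coded v -> @Dyckn K n (word v).
Proof.
move=> sv /(dyck_coded_path sv)[w dw ->].
exact: (lin_span_gen (fun w : (n.*2).-tuple bool => word (dyck_code w)) dw).
Qed.

Lemma Dyckn_ind n (Q : ncpoly -> Prop) :
  Q 0 -> (forall a x y, Q x -> Q y -> Q (a *: x + y)) ->
  (forall v, size v = n.*2 -> dyck_coded v -> Q (word v)) ->
  forall x, Dyckn n x -> Q x.
Proof.
move=> Q0 QZD Qw; apply: lin_span_ind => // w dw; apply: Qw.
  by rewrite /dyck_code size_belast size_tuple.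
exact: dyck_path_coded.
Qed.

(** The final height changes by exactly 2 per flip. For prefixes a one-sided bound suffices: raising
    letters lowers no prefix, and lowering letters costs a prefix at most 2 per flip. *)
Lemma flips_height b s v : flips b s (word v) = 0 \/ exists w,
  [/\ flips b s (word v) = word w, size w = size v,
   height w = height v + (if b then 2 else - 2) * (size s)%:Z &
   forall k, if b then height (take k v) <= height (take k w)
     else height (take k v) - 2 * (size s)%:Z <= height (take k w)].
Proof.
elim: s => [|p s [IH|[w [E sw hw aw]]]].
- by right; exists v; split=> // [|k]; case: b => /=; lia.
- by left; rewrite /flips /= -/(flips b s _) IH flip0.
rewrite /flips [foldr _ _ _]/= -/(flips b s _) E flip_word.
case: ifP => [/andP[lt nb]|_]; last by left.
right; exists (set_nth false w p b).
have H k := height_take_set_nth k lt nb.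
have sw' : size (set_nth false w p b) = size w.
  by rewrite size_set_nth; apply/maxn_idPr.
split=> [||| k]; rewrite ?sw' //.
  have := H (size w); rewrite take_size lt hw -{1}sw' take_size => ->.
  by case: (b); rewrite /=; lia.
by rewrite H; have := aw k; case: (b) => /=; case: ifP; lia.
Qed.

End Span.

(** * Words of permutations are Dyck codes *)

Lemma sum_crossings (X : nat -> nat) n k : (k <= X 0)%N -> (k <= X n.+1)%N ->
  (forall j, (j <= n)%N -> (X j < k)%N || (X j.+1 < k)%N -> X j != X j.+1) ->
  \sum_(j < n | (X j.+1 < k)%N)
     ((if (X j.+1 < X j)%N then 1 else -1) +
      (if (X j.+1 < X j.+2)%N then 1 else -1) : int) =
  (\sum_(j < n.+1) ((X j < k)%N (+) (X j.+1 < k)%N))%:Z.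
Proof.
move=> X0 Xn Xneq; rewrite big_split /=.
(* Each comparison is charged to the pair of neighbours [j], [j.+1] that it compares. The extra
   terms at the two ends vanish because the boundary values are at least [k]. *)
have -> : \sum_(j < n | (X j.+1 < k)%N) (if (X j.+1 < X j)%N then 1 else -1)
    = \sum_(j < n.+1) (if (X j.+1 < k)%N then
        if (X j.+1 < X j)%N then 1 else -1 else 0 : int).
  by rewrite big_ord_recr /= ltnNge Xn addr0 -big_mkcond.
have -> : \sum_(j < n | (X j.+1 < k)%N) (if (X j.+1 < X j.+2)%N then 1 else -1)
    = \sum_(j < n.+1) (if (X j < k)%N then
        if (X j < X j.+1)%N then 1 else -1 else 0 : int).
  by rewrite big_ord_recl /= ltnNge X0 add0r -big_mkcond.
rewrite -big_split (big_morph Posz PoszD (erefl 0%:Z)) /=.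
(* If both members of a pair lie below [k], the smaller contributes 1 and the larger -1; if just one
   does, it is the smaller and contributes 1. *)
apply: eq_bigr => j _; have := Xneq j (ltn_ord j).
by case: (ltnP (X j) k); case: (ltnP (X j.+1) k) => //= ? ? /(_ isT);
  case: (ltnP (X j.+1) (X j)); case: (ltnP (X j) (X j.+1)); lia.
Qed.

Section PermutationCodes.
Variable n : nat.
Implicit Type s : 'S_n.

Definition perm_mon s : {cmonom zindex} :=
  mmul (\big[mmul/mone]_(e in DB s) ucm (inl (val e)))
       (\big[mmul/mone]_(e in AB s) ucm (inr (val e))).

Lemma w1E (K : fieldType) s : w1 K s = << perm_mon s >>.
Proof.
by rewrite /w1 /perm_mon -malgUM; congr (_ * _); rewrite -malgU_prod.
Qed.

Lemma perm_mon_inl s (i : 'I_n) : perm_mon s (inl (val i)) = (i \in DB s).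
Proof.
rewrite cmM !cm_prod [X in (_ + X)%N]big1 => [|e _]; last by rewrite cmU.
rewrite addn0 (eq_bigr (fun e => nat_of_bool (e == i))); last first.
  by move=> e _; rewrite cmU.
have [iD|iD] := boolP (i \in DB s).
  by rewrite (bigD1 i) //= eqxx big1 // => e /andP[_ /negPf->].
by rewrite big1 // => e eD; case: eqP => // ei; rewrite -ei eD in iD.
Qed.

Lemma perm_mon_inr s (i : 'I_n) : perm_mon s (inr (val i)) = (i \in AB s).
Proof.
rewrite cmM !cm_prod [X in (X + _)%N]big1 => [|e _]; last by rewrite cmU.
rewrite add0n (eq_bigr (fun e => nat_of_bool (e == i))); last first.
  by move=> e _; rewrite cmU.
have [iD|iD] := boolP (i \in AB s).
  by rewrite (bigD1 i) //= eqxx big1 // => e /andP[_ /negPf->].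
by rewrite big1 // => e eD; case: eqP => // ei; rewrite -ei eD in iD.
Qed.

Lemma perm_mon_out s e : (n.*2 <= zrank e)%N -> perm_mon s e = 0%N.
Proof.
move=> le; rewrite cmM !cm_prod !big1 //.
  move=> i _; rewrite cmU; case: eqP => // ie; move: le; rewrite -ie /=.
  by have := ltn_ord i; lia.
move=> i _; rewrite cmU; case: eqP => // ie; move: le; rewrite -ie /=.
by have := ltn_ord i; lia.
Qed.

Lemma perm_mon_le1 s e : (perm_mon s e <= 1)%N.
Proof.
case: (ltnP (zrank e) n.*2) => [lt|/perm_mon_out-> //].
case: e lt => i /= lt; have lin : (i < n)%N by lia.
  by rewrite (perm_mon_inl s (Ordinal lin)) leq_b1.
by rewrite (perm_mon_inr s (Ordinal lin)) leq_b1.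
Qed.

Definition perm_code s : seq bool := theta_word n (perm_mon s).

Lemma w1_Psi (K : fieldType) s : w1 K s = Psi (word K (perm_code s)).
Proof.
rewrite w1E Psi_word mon_theta_word //; first exact: perm_mon_le1.
exact: perm_mon_out.
Qed.

Lemma nth_one_line s (j : 'I_n) : nth n (one_line s) j = s j.
Proof. by rewrite (nth_map j) ?size_enum_ord // nth_ord_enum. Qed.

Lemma mem_DB s (j : 'I_n) :
  (s j \in DB s) = (s j < nth n (n :: one_line s) j)%N.
Proof. by rewrite mem_imset ?inE //; apply: perm_inj. Qed.

Lemma mem_AB s (j : 'I_n) :
  (s j \in AB s) = (s j < nth n (one_line s) j.+1)%N.
Proof. by rewrite mem_imset ?inE //; apply: perm_inj. Qed.

Lemma height_theta_word k M : height (theta_word k M) =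
  \sum_(i < k) ((if M (inl (val i)) != 0%N then 1 else -1) +
                (if M (inr (val i)) != 0%N then 1 else -1)).
Proof.
elim: k => [|k IH]; first by rewrite big_ord0.
rewrite theta_wordS height_cat IH big_ord_recr /=; congr (_ + _).
by rewrite !height_cons /height /=; lia.
Qed.

(** The one-line word with its boundary letters: [n] stands at position 0 and, by the default of
    [nth], at [n.+1]; the permutation occupies the positions in between. *)
Definition letter s (j : nat) : nat := nth n (n :: one_line s) j.

Lemma size_one_line s : size (one_line s) = n.
Proof. by rewrite size_map size_enum_ord. Qed.

Lemma letter_out s : letter s n.+1 = n.
Proof. by rewrite /letter nth_default //= size_one_line. Qed.

Lemma letterS s (j : 'I_n) : letter s j.+1 = s j.
Proof. exact: nth_one_line. Qed.

(** A letter below [k] is not a boundary letter, and letters of a permutation at different places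
    differ. *)
Lemma letter_neq s j k : (k <= n)%N -> (j <= n)%N ->
  (letter s j < k)%N || (letter s j.+1 < k)%N -> letter s j != letter s j.+1.
Proof.
move=> kn; rewrite leq_eqVlt => /orP[/eqP->|lt] lk.
  by apply/eqP => e; move: lk; rewrite e orbb letter_out; lia.
move: lk; rewrite /letter => lk; rewrite [X in _ != X]/= (nth_one_line s (Ordinal lt)).
case: j lt lk => [|j] lt lk /=; first by rewrite gtn_eqF.
have lt' : (j < n)%N by lia.
rewrite (nth_one_line s (Ordinal lt')) (inj_eq val_inj) (inj_eq perm_inj).
by apply/eqP => /(congr1 val) /=; lia.
Qed.

Lemma height_perm_code s k : (k <= n)%N ->
  height (take k.*2 (perm_code s)) =
  (\sum_(j < n.+1) ((letter s j < k)%N (+) (letter s j.+1 < k)%N))%:Z.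
Proof.
move=> kn; rewrite take_theta_word // height_theta_word.
rewrite -sum_crossings //; [|by rewrite letter_out|by move=> j; apply: letter_neq].
rewrite (big_ord_widen n (fun i => (if perm_mon s (inl i) != 0%N then 1 else -1)
  + (if perm_mon s (inr i) != 0%N then 1 else -1) : int)) //.
rewrite (reindex_inj (@perm_inj _ s)) /=; apply: eq_big => j.
  by rewrite letterS.
move=> _; rewrite perm_mon_inl perm_mon_inr mem_DB mem_AB -!letterS !eqb0 !negbK.
by [].
Qed.

Lemma perm_code_dyck s : dyck_coded (perm_code s).
Proof.
case: (posnP n) => [n0|n_gt0].
  by left; apply/size0nil; rewrite size_theta_word n0.
have sz : size (perm_code s) = n.*2 by rewrite size_theta_word.
have hn : height (perm_code s) = 2.
  rewrite -[perm_code s]take_size sz height_perm_code //.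
  have lt_letter j : (j <= n.+1)%N -> (letter s j < n)%N = (0 < j <= n)%N.
    case: j => [|j]; first by rewrite /letter /= ltnn.
    rewrite /= ltnS leq_eqVlt => /orP[/eqP->|jn].
      by rewrite letter_out ltnn.
    by rewrite (letterS s (Ordinal jn)) ltn_ord jn.
  have one (c : 'I_n.+1) : (\sum_(j < n.+1) (j == c) = 1)%N.
    by rewrite (bigD1 c) //= eqxx big1 // => j /negPf->.
  (* For [k = n] exactly the first and the last pair, those with a boundary letter, have just one
     member below [n]. *)
  rewrite (eq_bigr (fun j : 'I_n.+1 => (j == ord0) + (j == ord_max))%N).
    by rewrite big_split /= !one.
  move=> j _; have := ltn_ord j; rewrite -!val_eqE /= ltnS => jn.
  by rewrite lt_letter ?(leqW jn) // lt_letter ?ltnS //=; lia.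
have even k : (0 < k <= n)%N -> 2 <= height (take k.*2 (perm_code s)).
  move=> /andP[k0 kn].
  have : 0 < height (take k.*2 (perm_code s)).
    rewrite height_perm_code // ltz_nat lt0n sum_nat_eq0.
    apply/negP => /forallP c.
    (* Without a crossing, induction from the left boundary would keep all letters at least [k],
       although the letter 0 occurs. *)
    have ge_k : forall i, (i <= n.+1)%N -> (k <= letter s i)%N.
      elim=> [_|i IH jn]; [exact: kn|have := IH (ltnW jn)].
      have := c (Ordinal jn) => /=; rewrite eqb0.
      by case: ltnP; case: ltnP.
    have := ge_k (s^-1 (Ordinal n_gt0))%g.+1.
    by rewrite letterS permKV /= => /(_ _); have := ltn_ord (s^-1 (Ordinal n_gt0))%g; lia.
  rewrite height_size size_takel ?sz ?leq_double //; lia.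
right; split=> // p; rewrite sz => /andP[p0 pn].
case: (boolP (odd p)) => op; last first.
  have -> : p = p./2.*2 by lia.
  by have := even p./2; lia.
(* An odd prefix falls one letter short of an even one, whose height is at least 2. *)
have pE : ((p./2).+1.*2 = p.+1)%N by lia.
have := even (p./2).+1; have := @height_take_succ p (perm_code s).
by rewrite sz pE; case: nth; lia.
Qed.

End PermutationCodes.

(** * Every Dyck code comes from a permutation *)

Section Surjectivity.
Variables (n : nat) (v : seq bool).

(* t lists nonempty blocks of letters less than k separated by single letters
   n, which stand for the gaps that larger letters will fill; a letter compares
   with its neighbours as prescribed by v.  Inserting k opens a new block, joins
   two blocks or extends one, according to the letters 2k and 2k+1 of v. *)
Definition blocks (k : nat) (t : seq nat) : Prop :=
  [/\ forall p, (nth n t p < k)%N \/ nth n t p = n,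
      forall i, (i < k)%N -> exists p, nth n t p = i,
      forall p q, nth n t p = nth n t q -> (nth n t p < n)%N -> p = q,
      forall p, (nth n t p < n)%N ->
        (nth n t p < nth n (n :: t) p)%N = nth false v (nth n t p).*2 /\
        (nth n t p < nth n t p.+1)%N = nth false v (nth n t p).*2.+1 &
      (forall p, (p <= size t)%N ->
         (nth n (n :: t) p < n)%N \/ (nth n t p < n)%N) /\
      height (take k.*2 v) = (count_mem n t).+1.*2%:Z].

Hypothesis sv : size v = n.*2.

Lemma height_take_double k : (k < n)%N ->
  height (take k.+1.*2 v) = height (take k.*2 v) +
   (if nth false v k.*2 then 1 else -1) + (if nth false v k.*2.+1 then 1 else -1).
Proof.
by move=> kn; rewrite doubleS !height_take_succ // sv; lia.
Qed.

(** Three of the four insertions are one assignment: at a gap it joins two blocks, at [size t] it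
    extends the last block to the right, and at [(size t).+1] it opens a new block, as [set_nth]
    pads position [size t] with a gap. *)
Lemma blocks_set_nth k t j : (k < n)%N -> blocks k t -> nth n t j = n ->
  (j <= (size t).+1)%N -> (size t < j)%N = nth false v k.*2 ->
  (size t <= j)%N = nth false v k.*2.+1 -> blocks k.+1 (set_nth n t j k).
Proof.
move=> kn [tk kt inj pat [sep ht]] tj js va vb.
(* Gaps are neither adjacent nor at the ends, so only a place at or past the end of the list has a
   neighbour equal to [n]. *)
have prev : (nth n (n :: t) j == n) = (size t < j)%N.
  case: ltnP => [lt|le].
    by rewrite nth_default ?eqxx.
  by apply/negbTE/eqP => e; have := sep j le; rewrite e tj ltnn => -[].
have next : (nth n t j.+1 == n) = (size t <= j)%N.
  case: leqP => [le|lt]; first by rewrite nth_default ?eqxx // ltnW.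
  by apply/negbTE/eqP => e; have := sep j.+1 lt; rewrite e /= tj ltnn => -[].
have nthE p : nth n (set_nth n t j k) p = if p == j then k else nth n t p.
  exact: nth_set_nth.
have prevE p : nth n (n :: set_nth n t j k) p =
    if p == j.+1 then k else nth n (n :: t) p.
  by case: p => //= p; rewrite nthE.
split.
- move=> p; rewrite nthE; case: eqP => _; first by left.
  by case: (tk p) => [lt|->]; [left; lia|right].
- move=> i; rewrite ltnS leq_eqVlt => /orP[/eqP->|i_k].
    by exists j; rewrite nthE eqxx.
  have [p pi] := kt i i_k.
  exists p; rewrite nthE; case: eqP => // pj.
  by move: i_k; rewrite -pi pj tj; lia.
- move=> p q; rewrite !nthE; case: eqP => [->|_]; case: eqP => [->|_] //.
  + by case: (tk q); lia.
  + by case: (tk p); lia.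
  + exact: inj.
- move=> p; rewrite prevE !nthE.
  have j1 : (j == j.+1) = false by lia.
  case: (p =P j) => [->|pj] lt.
    rewrite j1 eq_sym j1 -va -vb -prev -next.
    have gt x : (x < k)%N \/ x = n -> (k < x)%N = (x == n) by lia.
    split; apply: gt => //; case: (j) => [|i] /=; first by right.
    exact: tk.
  have ltk : (nth n t p < k)%N by case: (tk p) => // e; rewrite e ltnn in lt.
  have [<- <-] := pat p lt; split.
    by case: eqP => // e; move: ltk lt; rewrite e /= tj => -> ->.
  by case: eqP => // e; rewrite e tj ltk lt.
split.
- move=> p; rewrite size_set_nth prevE nthE => ps.
  case: eqP => [_|pj1]; first by left.
  case: eqP => [_|pj]; first by right.
  by apply: sep; lia.
rewrite height_take_double // ht -va -vb count_set_nth.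
(* When a gap is filled, the list does contain one, so the truncated subtraction in the count is
   exact. *)
have : ((j < size t)%N <= count_mem n t)%N.
  case: ltnP => // lt; rewrite -has_count; apply/hasP; exists n => //=.
  by rewrite -tj mem_nth.
rewrite tj /= eqxx ltn_eqF //; case: (ltnP (size t) j); case: (ltnP j (size t)); lia.
Qed.

(** The fourth insertion extends the first block to the left: [k] stands between the boundary letter
    and a smaller letter. *)
Lemma blocks_cons k t : (k < n)%N -> blocks k t ->
  nth false v k.*2 -> ~~ nth false v k.*2.+1 -> blocks k.+1 (k :: t).
Proof.
move=> kn [tk kt inj pat [sep ht]] va vb.
have t0 : (nth n t 0 < k)%N.
  by case: (tk 0%N) => // t0; have := sep 0%N isT; rewrite t0 /= ltnn => -[].
split.
- case=> [|p] /=; first by left.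
  by case: (tk p) => [lt|->]; [left; lia|right].
- move=> i; rewrite ltnS leq_eqVlt => /orP[/eqP->|/kt[p pi]]; first by exists 0%N.
  by exists p.+1.
- case=> [|p] [|q] //=.
  + by case: (tk q); lia.
  + by case: (tk p); lia.
  + by move=> e lt; rewrite (inj p q).
- case=> [|p] /=; first by rewrite kn va (negPf vb); split=> //; lia.
  move=> lt; have [<- <-] := pat p lt; split=> //.
  by case: p lt => [|p] //= lt; rewrite t0 lt.
split.
- case=> [|p] /=; first by right.
  rewrite ltnS => /sep; case: p => [|p] /=; last by [].
  by move=> _; left.
rewrite height_take_double // ht va (negPf vb) /= ltn_eqF //; lia.
Qed.

(** The induction starts at [k = 1], since the empty list violates the separation condition: the two
    boundary letters would be neighbours. *)
Lemma blocks1 : (0 < n)%N -> nth false v 0 -> nth false v 1 -> blocks 1 [:: 0%N].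
Proof.
move=> n0 v0 v1; split.
- by case=> [|p]; [left|right; rewrite nth_default].
- by case=> // _; exists 0%N.
- by case=> [|p] [|q] //=; rewrite ?nth_nil; lia.
- by case=> [|p] /=; rewrite ?nth_nil ?ltnn // v0 v1 n0.
split; first by case=> [|[|p]] //= _; [right|left].
by rewrite (height_take_double n0) double0 take0 v0 v1 /= ltn_eqF.
Qed.

Lemma blocks_exist k : dyck_coded v -> (0 < k <= n)%N -> exists t, blocks k t.
Proof.
case=> [v0|[h pos]]; first by move: sv; rewrite v0 /=; lia.
elim: k => // k IH /andP[_ kn].
have hp : 1 <= height (take k.+1.*2 v) by apply: pos; lia.
have hE := height_take_double kn.
case: (posnP k) => [k0|k_gt0].
  rewrite k0 double0 take0 in hE; exists [:: 0%N]; rewrite k0.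
  (* A positive height after two letters forces both to be [u]. *)
  have v01 : nth false v 0 && nth false v 1.
    by move: hp; rewrite k0 hE; case: nth; case: nth.
  by case/andP: v01 => v0 v1; apply: blocks1 => //; lia.
have [t tb] := IH (introT andP (conj k_gt0 (ltnW kn))).
have [tk kt inj pat [sep ht]] := tb.
rewrite ht in hE.
case va: (nth false v k.*2) hE; case vb: (nth false v k.*2.+1) => hE.
- exists (set_nth n t (size t).+1 k).
  by apply: blocks_set_nth; rewrite ?va ?vb ?nth_default ?ltnSn ?leqnSn.
- by exists (k :: t); apply: blocks_cons; rewrite ?va ?vb.
- exists (set_nth n t (size t) k).
  by apply: blocks_set_nth; rewrite ?va ?vb ?nth_default ?ltnn ?leqnn.
(* Two letters [d] lower the height by 2 and it stays positive, so the list has a gap to fill. *)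
- have nt : n \in t by rewrite -has_pred1 has_count; lia.
  have lt : (index n t < size t)%N by rewrite index_mem.
  exists (set_nth n t (index n t) k).
  by apply: blocks_set_nth; rewrite ?va ?vb ?nth_index //; lia.
Qed.

End Surjectivity.

Lemma dyck_coded_perm n v : size v = n.*2 -> dyck_coded v ->
  exists s : 'S_n, perm_code s = v.
Proof.
move=> sv dv; case: (posnP n) => [n0|n_gt0].
  have sc (s : 'S_n) : size (perm_code s) = 0%N by rewrite size_theta_word n0.
  by exists 1%g; rewrite (size0nil (sc _)) [v]size0nil // sv n0.
have [t [tn nt inj pat [sep ht]]] : exists t, blocks n v n t.
  by apply: blocks_exist => //; rewrite n_gt0 leqnn.
have hv : height v = 2 by case: dv => [v0|[]//]; move: sv; rewrite v0 /=; lia.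
(* The total height 2 leaves no gap, so the list consists of the letters below [n], each once. *)
have tlt p : (p < size t)%N -> (nth n t p < n)%N.
  move=> lt; case: (tn p) => // e.
  have : n \in t by rewrite -e mem_nth.
  rewrite -has_pred1 has_count; move: ht.
  by rewrite -sv take_size hv; lia.
have st : size t = n.
  have : perm_eq t (iota 0 n).
    apply: uniq_perm; rewrite ?iota_uniq //.
      by apply/(uniqP n) => p q pt _ /inj; apply; apply: tlt.
    move=> i; rewrite mem_iota /= add0n; apply/idP/idP => [/(nthP n)[p pt <-]|lt].
      exact: tlt.
    have [p pi] := nt i lt; rewrite -pi mem_nth // ltnNge; apply/negP => /(nth_default n); lia.
  by move=> /perm_size; rewrite size_iota.
have lt (j : 'I_n) : (nth n t j < n)%N by apply: tlt; rewrite st.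
have s_inj : injective (fun j => Ordinal (lt j)).
  by move=> j1 j2 /(congr1 val) /= e; apply/val_inj/(inj _ _ e (lt j1)).
exists (perm s_inj).
have one : one_line (perm s_inj) = t.
  apply: (@eq_from_nth _ n) => [|p]; rewrite size_one_line ?st // => pn.
  by rewrite (nth_one_line _ (Ordinal pn)) permE.
apply: (@eq_from_nth _ false) => [|p]; rewrite size_theta_word // => pn.
rewrite nth_theta_word //.
have pn2 : (p./2 < n)%N by lia.
have [j jp] : exists j, perm s_inj j = Ordinal pn2.
  by exists ((perm s_inj)^-1 (Ordinal pn2))%g; rewrite permKV.
have vj : nth n t j = p./2 by have := congr1 val jp; rewrite permE.
have [] := pat j (lt j); rewrite vj => p1 p2.
rewrite /zpos; case: ifP => op.
  rewrite (perm_mon_inr _ (Ordinal pn2)) -jp mem_AB one jp /= p2 eqb0 negbK.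
  by congr nth; lia.
rewrite (perm_mon_inl _ (Ordinal pn2)) -jp mem_DB one jp /= p1 eqb0 negbK.
by congr nth; lia.
Qed.

(** * Transport of the graded pieces and their products along [Psi] *)

Section Products.
Variable K : fieldType.
Local Notation zpoly := {malg K[{cmonom zindex}]}.
Local Notation ncpoly := {malg K[{fmonom bool}]}.
Local Notation word := (word K).
Local Notation DABn := (@DABn K).
Local Notation Dyckn := (@Dyckn K).
Local Notation Psi := (@Psi K).

Lemma Psi_linear : linear Psi.
Proof. exact: lin_ext_linear. Qed.

Lemma Theta_n_linear n : linear (@Theta_n K n).
Proof. exact: lin_ext_linear. Qed.

Lemma DABnZD n a f g : DABn n f -> DABn n g -> DABn n (a *: f + g).
Proof. exact: lin_spanZD. Qed.

Lemma DABn0 n : DABn n 0.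
Proof. exact: lin_span0. Qed.

Lemma DycknZD n a x y : Dyckn n x -> Dyckn n y -> Dyckn n (a *: x + y).
Proof. exact: lin_spanZD. Qed.

Lemma Dyckn0 n : Dyckn n 0.
Proof. exact: lin_span0. Qed.

(** This inclusion rests on [dyck_coded_perm]; the one in [Psi_Theta_n] rests on
    [perm_code_dyck]. *)
Lemma DABn_Psi n x : Dyckn n x -> DABn n (Psi x).
Proof.
move: x; apply: Dyckn_ind => [|a x y Dx Dy|v sv /(dyck_coded_perm sv)[s <-]].
- by rewrite Psi0; apply: DABn0.
- by rewrite Psi_linear; apply: DABnZD.
- by rewrite -w1_Psi; apply: lin_span_gen.
Qed.

Lemma Psi_Theta_n n f : DABn n f ->
  Dyckn n (Theta_n n f) /\ Psi (Theta_n n f) = f.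
Proof.
move: f; apply: lin_span_ind => [|a f g [Df fK] [Dg gK]|s _].
- by rewrite (linear_map0 (Theta_n_linear n)) Psi0; split=> //; apply: Dyckn0.
- rewrite (Theta_n_linear n a f g); split; first exact: DycknZD.
  rewrite (Psi_linear a (Theta_n n f) (Theta_n n g)).
  exact: (congr2 (fun u w => a *: u + w) fK gK).
- have sc : size (perm_code s) = n.*2 by rewrite size_theta_word.
  rewrite w1_Psi Theta_n_Psi_word //; split=> //.
  by apply: Dyckn_word sc _; apply: perm_code_dyck.
Qed.

Lemma Theta_n_Psi n x : Dyckn n x -> Theta_n n (Psi x) = x.
Proof.
move: x; apply: Dyckn_ind => [|a x y xK yK|v sv _].
- by rewrite Psi0 (linear_map0 (Theta_n_linear n)).
- rewrite (Psi_linear a x y) (Theta_n_linear n a (Psi x) (Psi y)).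
  exact: (congr2 (fun u w => a *: u + w) xK yK).
- exact: Theta_n_Psi_word.
Qed.

Lemma Psi_one : Psi (word [::]) = 1.
Proof.
rewrite Psi_word; congr (<< _ >>); apply/eqP/cmP => e.
by rewrite monE nth_nil cm1.
Qed.

Lemma ncpoly_mul_linearl g : linear (@ncpoly_mul K ^~ g).
Proof. exact: lin_ext_linear. Qed.

Lemma ncpoly_mul_linearr f : linear (@ncpoly_mul K f).
Proof.
apply: linear_big => w a x y.
by rewrite lin_ext_linear scalerDr !scalerA mulrC.
Qed.

Lemma ncpoly_mul_word w v : ncpoly_mul (word w) (word v) = word_mul K w v.
Proof. by rewrite /ncpoly_mul !lin_extU. Qed.

Lemma word_mul_closed n m w v : size w = n.*2 -> size v = m.*2 ->
  dyck_coded w -> dyck_coded v -> Dyckn (n + m) (word_mul K w v).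
Proof.
move=> sw sv dw dv; rewrite /word_mul.
have scat (s t : seq bool) : size s = size w -> size t = size v ->
    size (s ++ t) = (n + m).*2.
  by rewrite size_cat sw sv doubleD => -> ->.
case: ifP => [|/negbT].
  move=> /orP wv; rewrite wordM; apply: Dyckn_word; first exact: scat.
  by case: wv => /eqP->; rewrite ?cats0.
rewrite negb_or => /andP[/eqP w0 /eqP v0].
case: dw => // -[hw pw]; case: dv => // -[hv pv].
apply: lin_span_sum => T _; apply: lin_span_sum => S /eqP cS.
(* Of the two sets only the numbers of flips matter: one more letter is lowered than raised. *)
have : size [seq val i | i <- enum S] = (size [seq val i | i <- enum T]).+1.
  by rewrite !size_map -!cardE; apply: cS.
rewrite -[deta_seq _ _]/(flips true _ _) -[dpartial_seq _ _]/(flips false _ _).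
move: [seq val i | i <- enum S] [seq val i | i <- enum T] => qs ps pqs.
have [->|[w' [-> sw' hw' pw']]] := flips_height K true ps w.
  by rewrite mul0r; apply: Dyckn0.
have [->|[v' [-> sv' hv' pv']]] := flips_height K false qs v.
  by rewrite mulr0; apply: Dyckn0.
rewrite pqs /= in hw' pw' hv' pv'.
rewrite wordM; apply: Dyckn_word; first exact: scat.
right; rewrite height_cat hw' hv' hw hv; split; first by lia.
move=> k; rewrite size_cat sw' sv' => /andP[k0 kle]; rewrite take_cat sw'.
case: ltnP => [lt|le].
  by have := pw k; have := pw' k; rewrite k0 ltnW //=; lia.
rewrite height_cat hw' hw /=.
have /= := pv' (k - size w)%N; have := pv (k - size w)%N.
(* The first word ends at height [2 + 2 * size ps], which settles an empty prefix of the second. A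
   nonempty one loses at most [2 * size ps + 2], so its original height, at least 1, remains as
   lower bound. *)
case: (posnP (k - size w)) => [->|kpos]; first by rewrite !take0 /height /=; lia.
rewrite leq_subLR kle => /(_ isT); lia.
Qed.

Lemma ncpoly_mul_closed n m x y :
  Dyckn n x -> Dyckn m y -> Dyckn (n + m) (ncpoly_mul x y).
Proof.
move=> Dx Dy; move: x Dx; apply: Dyckn_ind => [|a x x' ? ?|w sw dw].
- by rewrite (linear_map0 (ncpoly_mul_linearl y)); apply: Dyckn0.
- by rewrite ncpoly_mul_linearl; apply: DycknZD.
move: y Dy; apply: Dyckn_ind => [|a y y' ? ?|v sv dv].
- by rewrite (linear_map0 (ncpoly_mul_linearr _)); apply: Dyckn0.
- by rewrite ncpoly_mul_linearr; apply: DycknZD.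
by rewrite ncpoly_mul_word; apply: word_mul_closed.
Qed.

Lemma eta_seq_linear s : linear (@eta_seq K s).
Proof. exact: (linear_foldr _ (zflip_linear true)). Qed.

Lemma partial_seq_linear s : linear (@partial_seq K s).
Proof. exact: (linear_foldr _ (zflip_linear false)). Qed.

Lemma malg_scalerAl (M : conomType) a (f g : {malg K[M]}) :
  (a *: f) * g = a *: (f * g).
Proof. by rewrite -!mul_malgC mulrA. Qed.

Lemma DABn_mul_linearl n m g : linear (@DABn_mul K n m ^~ g).
Proof.
rewrite /DABn_mul; case: ((n == 0%N) || (m == 0%N)).
  by move=> a x y; rewrite mulrDl malg_scalerAl.
apply: linear_big => T; apply: linear_big => S a x y.
by rewrite mulrDl malg_scalerAl partial_seq_linear eta_seq_linear.
Qed.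

Lemma DABn_mul_linearr n m f : linear (@DABn_mul K n m f).
Proof.
have GammaL : linear (@Gamma K n) by apply: lin_ext_linear.
rewrite /DABn_mul; case: ((n == 0%N) || (m == 0%N)).
  by move=> a x y; rewrite mulrDr malg_scalerAr.
apply: linear_big => T; apply: linear_big => S a x y.
by rewrite GammaL mulrDr malg_scalerAr partial_seq_linear eta_seq_linear.
Qed.

(** Keeping [N] apart from [n.*2] lets the target be the positions of a word, bounded by its [size],
    without a cast. *)
Lemma zrank_ord_bij n N : N = n.*2 ->
  exists2 h : 'I_n + 'I_n -> 'I_N, bijective h &
    forall e, val (h e) = zrank (index_of_ord e).
Proof.
move=> ->.
have lt (e : 'I_n + 'I_n) : (zrank (index_of_ord e) < n.*2)%N.
  by case: e => i /=; have := ltn_ord i; lia.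
exists (fun e => Ordinal (lt e)) => //.
apply: inj_card_bij; last by rewrite card_sum !card_ord addnn.
move=> e f /(congr1 val) /= /(can_inj zrankK).
by case: e => i; case: f => j //= [] /val_inj ->.
Qed.

Lemma perm_enum_imset (I J : finType) (h : I -> J) (A : {set I}) :
  injective h -> perm_eq (enum (h @: A)) [seq h i | i <- enum A].
Proof.
move=> hi; apply: uniq_perm; rewrite ?map_inj_uniq ?enum_uniq // => j.
rewrite mem_enum; apply/imsetP/mapP => -[i iA ->]; exists i => //.
  by rewrite mem_enum.
by move: iA; rewrite mem_enum.
Qed.

Lemma reindex_imset (I J : finType) (V : zmodType) (h : I -> J) (P : pred {set J})
    (F : {set J} -> V) : bijective h ->
  \sum_(B | P B) F B = \sum_(A : {set I} | P (h @: A)) F (h @: A).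
Proof.
move=> [g hK gK]; rewrite (reindex (fun A : {set I} => h @: A)) //.
exists (fun B : {set J} => g @: B) => A _.
  by rewrite -imset_comp (eq_imset _ hK) imset_id.
by rewrite -imset_comp (eq_imset _ gK) imset_id.
Qed.

Lemma DABn_mul_Psi_word n m w v : size w = n.*2 -> size v = m.*2 ->
  DABn_mul n m (Psi (word w)) (Psi (word v)) = Psi (word_mul K w v).
Proof.
move=> sw sv; rewrite /DABn_mul /word_mul.
have nil0 k (u : seq bool) : size u = k.*2 -> (u == [::]) = (k == 0%N).
  by rewrite -size_eq0 => ->; rewrite double_eq0.
rewrite (nil0 n w) // (nil0 m v) //; case: ifP => [/orP z0|_].
  case: z0 => /eqP k0.
    by rewrite (size0nil (etrans sw _)) ?k0 // Psi_one mul1r wordM.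
  by rewrite (size0nil (etrans sv _)) ?k0 // Psi_one mulr1 wordM cats0.
have [h hb hE] := zrank_ord_bij sw; have [g gb gE] := zrank_ord_bij sv.
rewrite (reindex_imset _ _ hb) (linear_map_sum _ _ _ Psi_linear).
apply: eq_bigr => T _.
rewrite (reindex_imset _ _ gb) (linear_map_sum _ _ _ Psi_linear).
apply: eq_big => [S|S _]; first by rewrite !card_imset //; exact: bij_inj.
(* Along the bijection the index set and its image give the same positions, possibly in different
   orders. *)
have listE k N (f : 'I_k + 'I_k -> 'I_N) (A : {set 'I_k + 'I_k}) :
    bijective f -> (forall e, val (f e) = zrank (index_of_ord e)) ->
  exists s, [/\ [seq index_of_ord e | e <- enum A] = [seq zpos p | p <- s],
                all (fun p => p < N)%N s &
                perm_eq s [seq val i | i <- enum (f @: A)]].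
  move=> fb fE; exists [seq val (f e) | e <- enum A]; split.
  - by rewrite -map_comp; apply: eq_map => e /=; rewrite fE zrankK.
  - by apply/allP => _ /mapP[e _ ->]; apply: ltn_ord.
  - rewrite perm_sym (map_comp val f); apply: perm_map.
    exact/perm_enum_imset/bij_inj.
have [sT [-> ltT permT]] := listE _ _ h T hb hE.
have [sS [eS ltS permS]] := listE _ _ g S gb gE.
have -> : [seq shift_index n (index_of_ord e) | e <- enum S] =
    [seq zpos p | p <- [seq (size w + p)%N | p <- sS]].
  rewrite (map_comp (shift_index n) (@index_of_ord m)) eS -!map_comp.
  by apply: eq_map => p /=; rewrite zpos_shift sw.
rewrite !Psi_word Gamma_mon // -Psi_word.
have Nwv : word_or_zero (size w + size v) (word (w ++ v)).
  by right; exists (w ++ v); rewrite ?size_cat.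
rewrite [partial_seq _ _](zflips_Psi false _ Nwv); last first.
  by apply/allP => _ /mapP[p /(allP ltS) lt ->]; rewrite ltn_add2l.
rewrite [eta_seq _ _](zflips_Psi true _ (word_or_zero_flips false _ Nwv)); last first.
  by apply: sub_all ltT => p /ltn_addr; apply.
have ww : word_or_zero (size w) (word w) by right; exists w.
have vv : word_or_zero (size v) (word v) by right; exists v.
rewrite -wordM (flips_cat true false sS ltT ww vv).
rewrite (perm_flips true _ permT) (perm_flips false _ permS).
by [].
Qed.

Lemma DABn_mul_Psi n m x y : Dyckn n x -> Dyckn m y ->
  DABn_mul n m (Psi x) (Psi y) = Psi (ncpoly_mul x y).
Proof.
move=> Dx Dy; move: x Dx; apply: Dyckn_ind => [|a x x' xE xE'|w sw _].
- rewrite (linear_map0 (ncpoly_mul_linearl y)) Psi0.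
  exact: linear_map0 (DABn_mul_linearl n m (Psi y)).
- rewrite (ncpoly_mul_linearl y a x x') !(Psi_linear a).
  rewrite (DABn_mul_linearl n m (Psi y) a (Psi x) (Psi x')).
  exact: (congr2 (fun u w => a *: u + w) xE xE').
move: y Dy; apply: Dyckn_ind => [|a y y' yE yE'|v sv _].
- rewrite (linear_map0 (ncpoly_mul_linearr _)) Psi0.
  exact: linear_map0 (DABn_mul_linearr n m (Psi (word w))).
- rewrite (ncpoly_mul_linearr (word w) a y y') !(Psi_linear a).
  rewrite (DABn_mul_linearr n m (Psi (word w)) a (Psi y) (Psi y')).
  exact: (congr2 (fun u w => a *: u + w) yE yE').
by rewrite ncpoly_mul_word; apply: DABn_mul_Psi_word.
Qed.

End Products.

(** * Closure of direct sums under graded products *)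

Section Graded.
Variables (K : fieldType) (V : lmodType K) (A : nat -> set V).
Hypothesis A0 : forall n, A n 0.
Hypothesis AZD : forall n a x y, A n x -> A n y -> A n (a *: x + y).

Lemma graded_one_closed e : A 0 e -> direct_sum A (graded_one e).
Proof.
move=> Ae; split; first by case=> [|n] //=; apply: A0.
by exists 1%N; case.
Qed.

Lemma graded_mul_closed (mul : nat -> nat -> V -> V -> V) f g :
  (forall n m y, mul n m 0 y = 0) -> (forall n m x, mul n m x 0 = 0) ->
  (forall n m x y, A n x -> A m y -> A (n + m) (mul n m x y)) ->
  direct_sum A f -> direct_sum A g -> direct_sum A (graded_mul mul f g).
Proof.
move=> mul0 mulr_0 mulA [Af [N fN]] [Ag [M gM]]; split.
  move=> k; rewrite /graded_mul; elim/big_ind: _ => //.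
    by move=> x y Ax Ay; rewrite -[x]scale1r; apply: AZD.
  move=> i _; have ik : (i <= k)%N by rewrite -ltnS.
  by rewrite -{1}(subnKC ik); apply: mulA.
(* In total degree at least [N + M], one of the two factors lies beyond its own bound. *)
exists (N + M)%N => k le; rewrite /graded_mul big1 // => i _.
case: (leqP N i) => [Ni|iN]; first by rewrite fN // mul0.
by rewrite gM ?mulr_0 //; lia.
Qed.

End Graded.

(** * The graded isomorphism *)

Section Isomorphism.
Variable K : fieldType.

(** Closure is known for Dyck codes, where heights are available, and is transported by [Psi]. *)
Lemma DABn_mul_closed n m f g :
  @DABn K n f -> DABn m g -> DABn (n + m) (DABn_mul n m f g).
Proof.
move=> /Psi_Theta_n[Df <-] /Psi_Theta_n[Dg <-]; rewrite DABn_mul_Psi //.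
exact/DABn_Psi/ncpoly_mul_closed.
Qed.

Lemma DAB_unital_closed : unital_closed (@DAB K) (@DAB_mul K) (@DAB_one K).
Proof.
split.
  apply: graded_one_closed (@DABn0 K) _ _; rewrite -Psi_one; apply: DABn_Psi.
  by apply: Dyckn_word => //; left.
move=> f g; apply: graded_mul_closed (@DABn0 K) (@DABnZD K) _ _ _ _ _ _.
- by move=> n m y; apply: (linear_map0 (DABn_mul_linearl n m y)).
- by move=> n m x; apply: (linear_map0 (DABn_mul_linearr n m x)).
- exact: DABn_mul_closed.
Qed.

Lemma Dyck_unital_closed :
  unital_closed (@Dyck K) (@Dyck_mul K) (@Dyck_one K).
Proof.
split.
  by apply: graded_one_closed (@Dyckn0 K) _ _; apply: Dyckn_word => //; left.
move=> f g; apply: graded_mul_closed (@Dyckn0 K) (@DycknZD K) _ _ _ _ _ _.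
- by move=> _ _ y; apply: (linear_map0 (ncpoly_mul_linearl y)).
- by move=> _ _ x; apply: (linear_map0 (ncpoly_mul_linearr x)).
- exact: ncpoly_mul_closed.
Qed.

Lemma Theta_isomorphism :
  alg_isomorphism (@DAB K) (@DAB_mul K) (@DAB_one K)
    (@Dyck K) (@Dyck_mul K) (@Dyck_one K) (@Theta K).
Proof.
have Theta0 n : Theta_n n (0 : {malg K[{cmonom zindex}]}) = 0.
  exact: linear_map0 (Theta_n_linear n).
split; first split.
- move=> f [Df [N fN]]; split=> [n|]; first by have [] := Psi_Theta_n (Df n).
  by exists N => n /fN; rewrite /Theta => ->; apply: Theta0.
- move=> f g /set_mem[Df _] /set_mem[Dg _] fg; apply/funext => n.
  have [_ <-] := Psi_Theta_n (Df n); have [_ <-] := Psi_Theta_n (Dg n).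
  exact: (congr1 (fun h => Psi (h n)) fg).
- move=> x [Dx [N xN]]; exists (fun n => Psi (x n)).
    split=> [n|]; first exact: DABn_Psi.
    by exists N => n /xN ->; rewrite Psi0.
  by apply/funext => n; apply: Theta_n_Psi.
- by move=> a f g _ _; apply/funext => n; apply: Theta_n_linear.
- apply/funext => n; rewrite /Theta /DAB_one /Dyck_one /graded_one.
  case: eqP => [->|_]; last exact: Theta0.
  apply: etrans (congr1 (@Theta_n K 0) (esym (Psi_one K))) _.
  by apply/Theta_n_Psi/Dyckn_word => //; left.
- move=> f g [Df _] [Dg _]; apply/funext => n.
  rewrite /Theta /DAB_mul /Dyck_mul /graded_mul.
  rewrite (linear_map_sum _ _ _ (Theta_n_linear n)); apply: eq_bigr => i _.
  have ik : (i <= n)%N by rewrite -ltnS.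
  have [Di fE] := Psi_Theta_n (Df i).
  have [Dj gE] := Psi_Theta_n (Dg (n - i)%N).
  (* Both factors are written as images under [Psi]; [Theta_n] then undoes [Psi] on the product,
     which by closure lies in the span of the codes. *)
  rewrite -{1}fE -{1}gE DABn_mul_Psi // Theta_n_Psi //.
  by have := ncpoly_mul_closed Di Dj; rewrite subnKC.
Qed.

End Isomorphism.

Local Open Scope complex_scope.

Theorem theorem3p2 (R : realType) :
  [/\ unital_closed (@DAB R[i]) (@DAB_mul R[i]) (@DAB_one R[i]),
      unital_closed (@Dyck R[i]) (@Dyck_mul R[i]) (@Dyck_one R[i]) &
      alg_isomorphism (@DAB R[i]) (@DAB_mul R[i]) (@DAB_one R[i])
        (@Dyck R[i]) (@Dyck_mul R[i]) (@Dyck_one R[i]) (@Theta R[i])].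
Proof.
split; [exact: DAB_unital_closed|exact: Dyck_unital_closed|].
exact: Theta_isomorphism.
Qed.
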